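(* Let $\ell>2$ be an integer. A partition $\lambda$ is an $(\ell,0)$-JM partition if and only if it is a generalized $\ell$-partition.
   Context: Partitions are identified with their Young diagrams; $(x,y)$ is the box in row $x$, column $y$. The hook length $h^\lambda_{(a,c)}$ of a box $(a,c)\in\lambda$ is the number of boxes of $\lambda$ to the right of it in its row or below it in its column, including itself. A partition $\lambda$ is an $(\ell,0)$-JM partition if there do NOT exist boxes $(a,b)$, $(a,y)$, $(x,b)$ in $\lambda$ with $\ell\mid h^\lambda_{(a,b)}$, $\ell\nmid h^\lambda_{(a,y)}$, $\ell\nmid h^\lambda_{(x,b)}$. An $\ell$-rim hook of a partition is a connected set of $\ell$ boxes of its Young diagram containing no $2\times2$ square whose removal leaves the Young diagram of a partition; it is horizontal if contained in one row and vertical if contained in one column. Two sets of boxes are adjacent if some box of one shares an edge with some box of the other. A partition $\lambda$ is a generalized $\ell$-partition if: (1) every $\ell$-rim hook of $\lambda$ is horizontal or vertical; (2) for any vertical (resp. horizontal) $\ell$-rim hook $R$ of $\lambda$ and any horizontal (resp. vertical) $\ell$-rim hook $S$ of the partition $\lambda\setminus R$, $R$ and $S$ are not adjacent; (3) every partition obtained from $\lambda$ by successively removing any set of horizontal and vertical $\ell$-rim hooks also satisfies (1) and (2). *)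

(* Defs.v *)
From mathcomp Require Import all_boot finmap.

Set Implicit Arguments.
Unset Strict Implicit.
Unset Printing Implicit Defensive.

Local Open Scope fset_scope.

Definition is_intpart (la : seq nat) : bool := sorted geq la && (0 \notin la).

(* A box is a pair (row, column); rows and columns are numbered from 0. *)
Definition box := (nat * nat)%type.

Definition diagram (la : seq nat) : {fset box} :=
  [fset ((i, j) : nat * nat) | i in iota 0 (size la), j in iota 0 (nth 0 la i)].

Definition hook_length (la : seq nat) (a c : nat) : nat :=
  #|` [fset b in diagram la | ((b.1 == a) && (c <= b.2)) ||
                              ((b.2 == c) && (a <= b.1))] |.

Definition JM_partition (l : nat) (la : seq nat) : Prop :=
  ~ exists a b x y : nat,
      [/\ (a, b) \in diagram la, (a, y) \in diagram la & (x, b) \in diagram la] /\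
      [/\ l %| hook_length la a b,
          ~~ (l %| hook_length la a y) &
          ~~ (l %| hook_length la x b)].

Definition share_edge (b c : box) : bool :=
  ((b.1 == c.1) && ((b.2 == c.2.+1) || (c.2 == b.2.+1))) ||
  ((b.2 == c.2) && ((b.1 == c.1.+1) || (c.1 == b.1.+1))).

Definition adjacent (A B : {fset box}) : Prop :=
  exists b c : box, [/\ b \in A, c \in B & share_edge b c].

Definition connected_boxes (A : {fset box}) : Prop :=
  forall b c : box, b \in A -> c \in A ->
    exists p : seq box,
      [/\ path share_edge b p, last b p = c & {subset p <= A}].

Definition has_square (A : {fset box}) : Prop :=
  exists i j : nat,
    [/\ (i, j) \in A, (i, j.+1) \in A, (i.+1, j) \in A & (i.+1, j.+1) \in A].

(* R is an l-rim hook of la, and mu is the partition la \ R. *)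
Definition rim_hook_removal (l : nat) (la : seq nat) (R : {fset box})
    (mu : seq nat) : Prop :=
  [/\ R `<=` diagram la, #|` R| = l, connected_boxes R & ~ has_square R] /\
  (is_intpart mu /\ diagram mu = diagram la `\` R).

Definition rim_hook (l : nat) (la : seq nat) (R : {fset box}) : Prop :=
  exists mu : seq nat, rim_hook_removal l la R mu.

Definition horizontal (R : {fset box}) : Prop :=
  exists i : nat, forall b : box, b \in R -> b.1 = i.

Definition vertical (R : {fset box}) : Prop :=
  exists j : nat, forall b : box, b \in R -> b.2 = j.

Definition rim_hooks_straight (l : nat) (la : seq nat) : Prop :=
  forall R : {fset box}, rim_hook l la R -> horizontal R \/ vertical R.

Definition no_adjacent_turn (l : nat) (la : seq nat) : Prop :=
  forall (R S : {fset box}) (mu : seq nat),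
    rim_hook_removal l la R mu -> rim_hook l mu S ->
    (vertical R /\ horizontal S) \/ (horizontal R /\ vertical S) ->
    ~ adjacent R S.

Inductive straight_reachable (l : nat) (la : seq nat) : seq nat -> Prop :=
| straight_reachable_refl : straight_reachable l la la
| straight_reachable_step (mu nu : seq nat) (R : {fset box}) :
    straight_reachable l la mu ->
    rim_hook_removal l mu R nu -> horizontal R \/ vertical R ->
    straight_reachable l la nu.

Definition generalized_partition (l : nat) (la : seq nat) : Prop :=
  [/\ rim_hooks_straight l la,
      no_adjacent_turn l la &
      forall mu : seq nat, straight_reachable l la mu ->
        rim_hooks_straight l mu /\ no_adjacent_turn l mu].

Lemma in_diagram (la : seq nat) (i j : nat) :
  ((i, j) \in diagram la) = (j < nth 0 la i).
Proof.
apply/imfset2P/idP => [[i' _ [j' + [-> ->]]]|lt_j].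
  by rewrite mem_iota.
exists i; last by exists j => //; rewrite mem_iota.
rewrite mem_iota /=; case: (ltnP i (size la)) => // le_i.
by rewrite nth_default in lt_j.
Qed.

(* Main.v *)
Require Import Defs.
From mathcomp Require Import all_boot finmap zify.

(* In the abacus of la, rows are beads, columns are gaps, and the hook length of
   a box is the distance from its gap up to its bead; so la fails to be an
   (l,0)-JM partition when some bead b and gap g < b on the same runner come
   with a gap g' < b and a bead b' > g off that runner (a violation).  Removing
   an l-rim hook moves a bead from s + l to the gap s; the hook is horizontal
   (vertical) when all positions strictly between are gaps (beads), and two
   successive straight hooks with base points s and t that turn are adjacent
   exactly when |s - t| = l.

   Bead moves cannot create violations, and both a bent hook and a turn are
   violations, so JM partitions are generalized l-partitions.  Conversely, take
   a smallest generalized l-partition with a violation (b, g, g', b'): no bead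
   move preserves a violation.  If b - g > l this forces a turn.  If b - g = l,
   the positions between g and b are, say, all beads; then g' can be taken in
   ]g - l, g[, straightness of the hook at g' gives g' = g + 1 - l, and after
   moving g + 1 to g' the hook at g has a gap at g + 1 and a bead at g + 2. *)

Set Implicit Arguments.
Unset Strict Implicit.
Unset Printing Implicit Defensive.

(** * Abacus of a partition *)

(** A downward closed predicate holds on an initial segment, whose length is its count. This turns
    each count below into a comparison [i < _], and equalities of counts into [eq_lt_nat]. *)
Lemma count_downset (P : pred nat) (n i : nat) :
  (forall j k, j <= k -> P k -> P j) ->
  (i < count P (iota 0 n)) = (i < n) && P i.
Proof.
elim: n P i => [|n IHn] P i downP; first by rewrite ltn0.
rewrite /= -[1]addn0 iotaDl count_map.
have [P0|nP0] := boolP (P 0).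
  case: i => [|i]; first by rewrite P0.
  rewrite add1n !ltnS IHn //= => j k le_jk; exact: downP.
have nP k : P k = false by apply: contraNF nP0; apply: downP.
by rewrite (eq_count (a2 := pred0)) ?count_pred0 ?nP ?andbF // => k /=; rewrite nP.
Qed.

Lemma leq_lt_nat (m n : nat) : (forall i, i < m -> i < n) -> m <= n.
Proof. by case: m => // m; apply. Qed.

Lemma eq_lt_nat (m n : nat) : (forall i, (i < m) = (i < n)) -> m = n.
Proof.
by move=> eq_mn; apply/eqP; rewrite eqn_leq !leq_lt_nat // => i; rewrite eq_mn.
Qed.

Lemma intpart_antitone (la : seq nat) (i j : nat) :
  is_intpart la -> i <= j -> nth 0 la j <= nth 0 la i.
Proof.
case/andP=> sla _ le_ij; case: (ltnP j (size la)) => [lt_j|ge_j]; last first.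
  by rewrite (nth_default _ ge_j).
have geq_trans : transitive geq by move=> x y z le_xy le_zx; apply: leq_trans le_xy.
by apply: (sorted_leq_nth geq_trans leqnn 0 sla); rewrite ?inE ?(leq_ltn_trans le_ij).
Qed.

(* The south-east border of la, in the strip of the first N rows, is a lattice
   path from (N, 0); rim N la p is the row of its p-th lattice point, whose
   column is p + rim N la p - N.  Step p goes up when p is a bead of the abacus
   of la, and right when p is a gap. *)
Definition rim (N : nat) (la : seq nat) (p : nat) : nat :=
  count (fun i => p + i < nth 0 la i + N) (iota 0 N).

Definition bead (N : nat) (la : seq nat) (p : nat) : bool :=
  rim N la p.+1 < rim N la p.

Lemma ltn_rim (N : nat) (la : seq nat) (p i : nat) : is_intpart la ->
  (i < rim N la p) = (i < N) && (p + i < nth 0 la i + N).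
Proof.
move=> hla; apply: count_downset => j k le_jk.
by have := intpart_antitone hla le_jk; lia.
Qed.

Lemma in_diagram_rim (N : nat) (la : seq nat) (i j : nat) :
  is_intpart la -> size la <= N ->
  ((i, j) \in diagram la) = (i < rim N la (j + N - i)).
Proof.
move=> hla hN; rewrite in_diagram ltn_rim //.
case: (ltnP i N) => [|le_i] /=; first by lia.
by rewrite nth_default // (leq_trans hN).
Qed.

Lemma rim0 (N : nat) (la : seq nat) : is_intpart la -> rim N la 0 = N.
Proof. by move=> hla; apply: eq_lt_nat => i; rewrite ltn_rim //; lia. Qed.

Lemma rimS (N : nat) (la : seq nat) (p : nat) : is_intpart la ->
  rim N la p = rim N la p.+1 + bead N la p.
Proof.
move=> hla; have: rim N la p.+1 <= rim N la p <= (rim N la p.+1).+1.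
  apply/andP; split; apply: leq_lt_nat => i.
    by rewrite !ltn_rim //; lia.
  case: i => // i; rewrite ltnS !ltn_rim //.
  by have := intpart_antitone hla (leqnSn i); lia.
by rewrite /bead; lia.
Qed.

(** The border path starts in column 0 and never moves left, so the truncated subtraction in the
    column [p + rim N la p - N] is exact. *)
Lemma rim_geq (N : nat) (la : seq nat) (p : nat) : is_intpart la ->
  N <= p + rim N la p.
Proof.
move=> hla; elim: p => [|p IHp]; first by rewrite rim0.
by have := rimS N p hla; lia.
Qed.

Lemma rim_antitone (N : nat) (la : seq nat) (p q : nat) : is_intpart la ->
  p <= q -> rim N la q <= rim N la p.
Proof.
by move=> hla le_pq; apply: leq_lt_nat => i; rewrite !ltn_rim //; lia.
Qed.

(** Beads are the beta-numbers: with [a := rim N la p.+1], the bead [p] is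
    [nth 0 la a + N - a.+1]. *)
Lemma bead_row (N : nat) (la : seq nat) (p : nat) : is_intpart la ->
  bead N la p -> nth 0 la (rim N la p.+1) + N = (p + rim N la p.+1).+1.
Proof.
move=> hla bp; have := ltn_rim N p (rim N la p.+1) hla.
have := ltn_rim N p.+1 (rim N la p.+1) hla; rewrite ltnn -/(bead N la p) bp.
by lia.
Qed.

(** A gap is the horizontal step at the foot of column [p + rim N la p - N], so the rows reaching
    beyond that column are those above the step. *)
Lemma gap_column (N : nat) (la : seq nat) (p i : nat) :
  is_intpart la -> size la <= N -> ~~ bead N la p ->
  (p + rim N la p < nth 0 la i + N) = (i < rim N la p).
Proof.
move=> hla hN gp; have eq_rim := rimS N p hla; have geN := rim_geq N p hla.
have gt_i := intpart_antitone hla (i := i) (j := (rim N la p).-1).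
have le_i := intpart_antitone hla (i := rim N la p) (j := i).
have := ltn_rim N p.+1 (rim N la p).-1 hla.
have := ltn_rim N p (rim N la p) hla; rewrite ltnn.
have := nth_default 0 (s := la) (n := i).
by case: (ltnP i (rim N la p)); lia.
Qed.

Lemma bead_of_row (N : nat) (la : seq nat) (a : nat) :
  is_intpart la -> a < N ->
  exists2 p, bead N la p & rim N la p.+1 = a.
Proof.
move=> hla lt_a; exists (nth 0 la a + N - a.+1); last first.
  apply: eq_lt_nat => i; rewrite ltn_rim //.
  have := intpart_antitone hla (i := i) (j := a).
  have := intpart_antitone hla (i := a) (j := i).
  by lia.
rewrite /bead; apply: leq_trans (_ : a.+1 <= _); last first.
  by rewrite ltn_rim //; lia.
rewrite ltnS; apply: leq_lt_nat => i; rewrite ltn_rim //.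
have := intpart_antitone hla (i := a) (j := i).
by lia.
Qed.

Lemma gap_of_column (N : nat) (la : seq nat) (c : nat) :
  is_intpart la -> size la <= N ->
  exists2 q, ~~ bead N la q & c + N = q + rim N la q.
Proof.
move=> hla hN; pose k := count (fun i => c < nth 0 la i) (iota 0 N).
have kP i : (i < k) = (i < N) && (c < nth 0 la i).
  apply: count_downset => j m le_jm lt_c.
  exact: leq_trans lt_c (intpart_antitone hla le_jm).
have le_k : k <= N by rewrite -[leqRHS](size_iota 0) count_size.
have rimE q : q \in [:: c + N - k; (c + N - k).+1] -> rim N la q = k.
  move=> hq; apply: eq_lt_nat => i; rewrite ltn_rim //.
  have := kP i; have := nth_default 0 (s := la) (n := i).
  by move: hq; rewrite !inE; lia.
(* [k] is the length of column [c]; the path is at row [k] both before and after the step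
   [c + N - k], which is therefore a gap. *)
exists (c + N - k); last by rewrite rimE ?inE ?eqxx //; lia.
by rewrite /bead !rimE ?inE ?eqxx ?orbT // ltnn.
Qed.

(** * Hook lengths as differences of positions *)

Lemma hook_lengthE (la : seq nat) (a c k : nat) :
  c < nth 0 la a -> (forall i, (c < nth 0 la i) = (i < k)) ->
  hook_length la a c = nth 0 la a - c + (k - a.+1).
Proof.
move=> lt_c kP.
(* The row part contains the corner and the column part starts just below it, so no box is listed
   twice. *)
pose s := [seq (a, y) | y <- iota c (nth 0 la a - c)] ++
          [seq (x, c) | x <- iota a.+1 (k - a.+1)].
have us : uniq s.
  rewrite cat_uniq !map_inj_uniq ?iota_uniq => [|x y []|x y []] //=.
  rewrite andbT; apply/hasPn => _ /mapP[x + ->]; rewrite mem_iota => lt_x.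
  by apply/mapP => -[y _ []]; lia.
rewrite /hook_length; set A := (X in #|` X|).
have -> : A = [fset b | b in s]%fset.
  apply/fsetP=> -[i j]; rewrite !inE /= in_diagram.
  apply/andP/orP => [[lt_j /orP[/andP[/eqP eqi le_c]|/andP[/eqP eqj le_a]]]|[]].
  - by left; subst i; rewrite map_f // mem_iota; lia.
  - have [->|ne_i] := eqVneq i a; first by left; rewrite map_f // mem_iota; lia.
    by right; subst j; rewrite map_f // mem_iota; have := kP i; lia.
  - by case/mapP=> y; rewrite mem_iota => lt_y [-> ->]; lia.
  - by case/mapP=> x; rewrite mem_iota => lt_x [-> ->]; have := kP x; lia.
by rewrite card_fseq undup_id // size_cat !size_map !size_iota.
Qed.

Lemma hook_position (N : nat) (la : seq nat) (a c p q : nat) :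
  is_intpart la -> size la <= N -> bead N la p -> ~~ bead N la q ->
  rim N la p.+1 = a -> c + N = q + rim N la q ->
  ((a, c) \in diagram la) = (q < p) /\
  (q < p -> hook_length la a c = p - q).
Proof.
move=> hla hN bp gq eqa eqc.
have eqp := bead_row hla bp; rewrite eqa in eqp.
have kP i : (c < nth 0 la i) = (i < rim N la q).
  by rewrite -gap_column //; lia.
have box_pos : ((a, c) \in diagram la) = (q < p).
  rewrite in_diagram kP; have [lt_pq|le_pq|eq_pq] := ltngtP p q.
  - by have := rim_antitone N hla lt_pq; lia.
  - by have := rim_antitone N hla le_pq; have := rimS N q hla; have := rimS N p hla; lia.
  - by move: gq; rewrite -eq_pq bp.
split=> // lt_qp; have := box_pos; rewrite in_diagram lt_qp => lt_c.
rewrite (hook_lengthE lt_c kP); have := kP a; lia.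
Qed.

(* JM_partition fails exactly when the bead set X carries such a quadruple:
   rows are beads, columns are gaps and hook lengths are differences. *)
Definition violation (l : nat) (X : pred nat) : Prop :=
  exists b g g' b' : nat,
    [/\ X b, ~~ X g, ~~ X g' & X b'] /\
    [/\ g < b, g' < b & g < b'] /\
    [/\ l %| b - g, ~~ (l %| b - g') & ~~ (l %| b' - g)].

Lemma JM_violation (N l : nat) (la : seq nat) :
  is_intpart la -> size la <= N ->
  JM_partition l la <-> ~ violation l (bead N la).
Proof.
move=> hla hN; split=> nH H; apply: nH.
  case: H => b [g [g' [b' [[Xb Xg Xg' Xb'] [[lt_gb lt_g'b lt_gb'] H]]]]].
  have colE q : q + rim N la q - N + N = q + rim N la q.
    by rewrite subnK // rim_geq.
  exists (rim N la b.+1), (g + rim N la g - N).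
  exists (rim N la b'.+1), (g' + rim N la g' - N).
  have pos p q := @hook_position N la _ _ p q hla hN.
  have [e1 e1'] := pos _ _ _ _ Xb Xg erefl (colE _).
  have [e2 e2'] := pos _ _ _ _ Xb Xg' erefl (colE _).
  have [e3 e3'] := pos _ _ _ _ Xb' Xg erefl (colE _).
  by rewrite e1 e2 e3 e1' ?e2' ?e3'.
case: H => a [c [a' [c' [[Dac Dac' Da'c] H]]]].
have rowN i j : (i, j) \in diagram la -> i < N.
  by rewrite in_diagram; case: (ltnP i N) => // ge_i; rewrite nth_default // (leq_trans hN).
have [b Xb eqa] := bead_of_row hla (rowN _ _ Dac).
have [b' Xb' eqa'] := bead_of_row hla (rowN _ _ Da'c).
have [g Xg eqc] := gap_of_column c hla hN.
have [g' Xg' eqc'] := gap_of_column c' hla hN.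
exists b, g, g', b'; split=> //.
have [e1 e1'] := hook_position hla hN Xb Xg eqa eqc.
have [e2 e2'] := hook_position hla hN Xb Xg' eqa eqc'.
have [e3 e3'] := hook_position hla hN Xb' Xg eqa' eqc.
by rewrite -e1 -e2 -e3 -e1' -?e2' -?e3' -?e1 -?e2 -?e3.
Qed.

(** * Rim hooks as bead moves *)

(* Removing an l-rim hook moves the bead of the abacus at s + l to the gap s. *)
Definition moved (l : nat) (X : pred nat) (s : nat) : pred nat :=
  fun p => (p == s) || ((p != s + l) && X p).

(** A rim hook removal seen on the border paths: the new path runs one box further inside on the
    diagonals [s + 1] to [s + l], and agrees with the old one elsewhere. *)
Definition rim_shift (N l : nat) (la mu : seq nat) (s : nat) : Prop :=
  forall p, rim N la p = rim N mu p + (s < p <= s + l).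

(** The box whose lower right corner is the [p]-th lattice point of the border. *)
Definition rim_box (N : nat) (la : seq nat) (p : nat) : box :=
  ((rim N la p).-1, p + (rim N la p).-1 - N).

Lemma rim_shift_bead (N l : nat) (la mu : seq nat) (s : nat) :
  is_intpart la -> is_intpart mu -> 0 < l -> rim_shift N l la mu s ->
  [/\ ~~ bead N la s, bead N la (s + l) & bead N mu =1 moved l (bead N la) s].
Proof.
move=> hla hmu l_gt0 sh.
have step p : rim N mu p.+1 + (s < p.+1 <= s + l) + bead N la p =
              rim N mu p.+1 + bead N mu p + (s < p <= s + l).
  by rewrite -sh -(rimS N p hla) -(rimS N p hmu) sh.
split; [by have := step s; lia | by have := step (s + l); lia|].
by move=> p; have := step p; rewrite /moved; case: eqP; case: eqP; lia.
Qed.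

(** The diagonal of [(i, j)] meets the border at the point [j + N - i], so each diagonal from
    [s + 1] to [s + l] loses exactly its last box. *)
Lemma rim_shift_boxP (N l : nat) (la mu : seq nat) (s : nat) (b : box) :
  is_intpart la -> is_intpart mu -> size la <= N -> size mu <= N ->
  rim_shift N l la mu s ->
  b \in (diagram la `\` diagram mu)%fset <->
  exists2 p, s < p <= s + l & b = rim_box N la p.
Proof.
case: b => i j hla hmu hN hM sh; rewrite in_fsetD.
rewrite (in_diagram_rim i j hla hN) (in_diagram_rim i j hmu hM).
split=> [|[p sp [-> ->]]].
  have := sh (j + N - i); have := ltn_rim N (j + N - i) i hla.
  move=> e1 e2 hij; exists (j + N - i); first by lia.
  by congr (_, _); lia.
have shp := sh p; have geN := rim_geq N p hmu.
have -> : p + (rim N la p).-1 - N + N - (rim N la p).-1 = p by lia.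
by lia.
Qed.

Lemma rim_box_inj (N l : nat) (la mu : seq nat) (s : nat) :
  is_intpart mu -> rim_shift N l la mu s ->
  {in [pred p | s < p <= s + l] &, injective (rim_box N la)}.
Proof.
move=> hmu sh p q; rewrite !inE => sp sq [] er ec.
by have := rim_geq N p hmu; have := rim_geq N q hmu; have := sh p; have := sh q; lia.
Qed.

Lemma card_rim_shift (N l : nat) (la mu : seq nat) (s : nat) :
  is_intpart la -> is_intpart mu -> size la <= N -> size mu <= N ->
  rim_shift N l la mu s -> #|` (diagram la `\` diagram mu)%fset| = l.
Proof.
move=> hla hmu hN hM sh; pose t := [seq rim_box N la p | p <- iota s.+1 l].
have ut : uniq t.
  rewrite map_inj_in_uniq ?iota_uniq // => p q; rewrite !mem_iota => hp hq.
  by apply: (rim_box_inj hmu sh); rewrite inE; lia.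
have -> : (diagram la `\` diagram mu)%fset = [fset b | b in t]%fset.
  apply/fsetP => b; have -> : (b \in [fset b | b in t]%fset) = (b \in t) by rewrite !inE.
  apply/idP/mapP.
    case/(rim_shift_boxP _ hla hmu hN hM sh) => p hp ->.
    by exists p; rewrite // mem_iota; lia.
  case=> p; rewrite mem_iota => hp ->.
  by apply/(rim_shift_boxP _ hla hmu hN hM sh); exists p => //; lia.
by rewrite card_fseq undup_id // size_map size_iota.
Qed.

(** * From rim hooks to border shifts *)

Definition content (N : nat) (b : box) : nat := b.2 + N - b.1.

(** A discrete intermediate value theorem: crossing an edge changes the content by at most one. *)
Lemma path_content (N r : nat) (b : box) (s : seq box) :
  path share_edge b s -> content N b <= r <= content N (last b s) ->
  exists2 c, c \in b :: s & content N c = r.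
Proof.
elim: s b => [|c s IHs] b /=.
  by move=> _ hr; exists b; rewrite ?mem_head //; lia.
case/andP=> ebc pcs hr; have [eqr|ne_r] := eqVneq (content N b) r.
  by exists b; rewrite ?mem_head.
have [||d ds eqd] := IHs c => //; last by exists d; rewrite // inE ds orbT.
move: ebc ne_r hr; rewrite /share_edge /content.
by case: b c {IHs pcs} => [? ?] [? ?] /=; lia.
Qed.

(** Without a square, [R] has at most one box on each diagonal; by connectedness the diagonals it
    meets form an interval; its cardinality makes the length of that interval [l]. *)
Lemma rim_hook_shift (N l : nat) (la mu : seq nat) (R : {fset box}) :
  is_intpart la -> size la <= N -> 0 < l -> rim_hook_removal l la R mu ->
  [/\ size mu <= N, R = (diagram la `\` diagram mu)%fset &
      exists s, rim_shift N l la mu s].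
Proof.
move=> hla hN l_gt0 [[subR cardR connR nsqR] [hmu eqmu]].
have subD b : b \in diagram mu -> b \in diagram la.
  by rewrite eqmu in_fsetD => /andP[].
have eqR : R = (diagram la `\` diagram mu)%fset.
  by rewrite eqmu fsetDK.
have hM : size mu <= N.
  rewrite leqNgt; apply/negP => lt_N; case/andP: (hmu) => _ /negP[].
  have := subD (N, 0); rewrite !in_diagram (nth_default _ hN) ltnn.
  by case: posnP => [<- _|_ /(_ isT) //]; rewrite mem_nth.
split=> //.
have rimD i p : (i < rim N la p) = (i < N) && ((p + i < N) || ((i, p + i - N) \in diagram la)).
  by rewrite ltn_rim // in_diagram; lia.
have rimM i p : (i < rim N mu p) = (i < N) && ((p + i < N) || ((i, p + i - N) \in diagram mu)).
  by rewrite ltn_rim // in_diagram; lia.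
have le_rim p : rim N mu p <= rim N la p.
  apply: leq_lt_nat => i; rewrite rimD rimM.
  by case: (i < N) => //=; case: (p + i < N) => //=; apply: subD.
have inR i j : ((i, j) \in R) = (rim N mu (j + N - i) <= i < rim N la (j + N - i)).
  by rewrite eqR in_fsetD (in_diagram_rim i j hla hN) (in_diagram_rim i j hmu hM) -leqNgt.
(* Two removed boxes on the diagonal [p] would span a 2 by 2 square whose other corners lie on the
   diagonals [p - 1] and [p + 1]. *)
have rim_le p : rim N la p <= (rim N mu p).+1.
  rewrite leqNgt; apply/negP => lt_p; apply: nsqR.
  have [q eqp] : exists q, p = q.+1.
    by case: p lt_p => [|q]; [rewrite !rim0 // ltnNge leqnSn | exists q].
  have geN := rim_geq N p hmu; have gtN := ltn_rim N p (rim N mu p).+1 hla.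
  exists (rim N mu p), (p + rim N mu p - N); rewrite !inR.
  have -> : p + rim N mu p - N + N - rim N mu p = p by lia.
  have -> : (p + rim N mu p - N).+1 + N - rim N mu p = p.+1 by lia.
  have -> : p + rim N mu p - N + N - (rim N mu p).+1 = q by lia.
  have -> : (p + rim N mu p - N).+1 + N - (rim N mu p).+1 = p by lia.
  have := rimS N p hla; have := rimS N p hmu.
  have := rimS N q hla; have := rimS N q hmu; rewrite -eqp.
  by split; lia.
pose P p := rim N mu p < rim N la p.
have boxP p : P p -> exists2 b, b \in R & content N b = p.
  rewrite /P => Pp; have geN := rim_geq N p hmu.
  have := ltn_rim N p (rim N mu p) hla.
  exists (rim N mu p, p + rim N mu p - N); last by rewrite /content /=; lia.
  by rewrite inR (_ : p + _ - N + N - _ = p); lia.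
have P_box b : b \in R -> P (content N b).
  by case: b => i j; rewrite inR /P /content /=; lia.
have convP p q r : P p -> P q -> p <= r <= q -> P r.
  case/boxP=> b Rb <- /boxP[c Rc <-] hr.
  have [t [pt lt sub_t]] := connR b c Rb Rc.
  have [|d] := path_content (N := N) (r := r) pt; first by rewrite lt.
  by rewrite inE => /predU1P[->|/sub_t Rd] <-; apply: P_box.
have exP : exists p, P p.
  have /fset0Pn[b Rb] : R != fset0 by rewrite -cardfs_gt0 cardR.
  by exists (content N b); apply: P_box.
have leP p : P p -> p <= nth 0 la 0 + N.
  rewrite /P => Pp; have := ltn_rim N p 0 hla; lia.
case: (ex_minnP exP) (ex_maxnP exP leP) => m Pm min_m [e Pe max_e].
have m_gt0 : 0 < m.
  by case: m Pm {min_m} => //; rewrite /P !rim0 // ltnn.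
(* The shift starts one before the least diagonal [m] met by [R]; counting boxes then identifies its
   length with [l]. *)
have sh : rim_shift N (e.+1 - m) la mu m.-1.
  move=> p; have := le_rim p; have := rim_le p.
  have := min_m p; have := max_e p; have := convP m e p Pm Pe.
  by have := min_m e Pe; rewrite /P; lia.
have := card_rim_shift hla hmu hN hM sh; rewrite -eqR cardR => eql.
by exists m.-1; rewrite eql.
Qed.

(** * From bead moves to partitions *)

Lemma nth_filter_pos (s : seq nat) (i : nat) :
  (forall j k, j <= k -> nth 0 s k <= nth 0 s j) ->
  nth 0 [seq x <- s | 0 < x] i = nth 0 s i.
Proof.
elim: s i => [|x s IHs] i anti; first by [].
have antis j k : j <= k -> nth 0 s k <= nth 0 s j by move=> le_jk; apply: (anti j.+1 k.+1).
rewrite /=; case: (posnP x) => [x0|x_gt0]; last by case: i => //= i; apply: IHs.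
rewrite IHs //; have z j : nth 0 s j = 0 by have := anti 0 j.+1 isT; rewrite /= x0; lia.
by case: i => [|i] /=; rewrite !z ?x0.
Qed.

(** Every lattice path from row [N] up to row 0 bounds a partition: its rows are read off from the
    path, and the empty ones dropped. *)
Lemma rim_realize (N M : nat) (rho : nat -> nat) :
  rho 0 = N -> (forall p, rho p.+1 <= rho p <= (rho p.+1).+1) -> rho M = 0 ->
  exists mu, [/\ is_intpart mu, size mu <= N & rim N mu =1 rho].
Proof.
move=> rho0 rhoS rhoM.
have rho_anti p q : p <= q -> rho q <= rho p.
  elim: q => [|q IHq]; first by case: p.
  by rewrite leq_eqVlt => /predU1P[-> //|/IHq]; have := rhoS q; lia.
have rho_lip p q : p <= q -> p + rho p <= q + rho q.
  elim: q => [|q IHq]; first by case: p.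
  by rewrite leq_eqVlt => /predU1P[-> //|/IHq]; have := rhoS q; lia.
(* Row [i] gets the columns [j] that [in_diagram_rim] prescribes; no column from [M] on qualifies,
   as [rho] vanishes there. *)
pose part i := count (fun j => i < rho (j + N - i)) (iota 0 M).
have partP i j : i < N -> (j < part i) = (i < rho (j + N - i)).
  move=> lt_i; rewrite count_downset => [|j1 j2 le_j hi]; last first.
    by have := rho_anti (j1 + N - i) (j2 + N - i); lia.
  by case: ltnP => //= le_M; have := rho_anti M (j + N - i); lia.
have part_anti i : i.+1 < N -> part i.+1 <= part i.
  move=> lt_i; apply: leq_lt_nat => j; rewrite !partP ?(ltnW lt_i) //.
  by have := rhoS (j + N - i.+1); rewrite (_ : (j + N - i.+1).+1 = j + N - i); lia.
pose s := mkseq part N.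
have s_anti i j : i <= j -> nth 0 s j <= nth 0 s i.
  case: (ltnP j N) => [lt_j|le_j]; last by rewrite (nth_default _ (s := s)) ?size_mkseq.
  move=> le_ij; rewrite !nth_mkseq ?(leq_ltn_trans le_ij) //.
  elim: j le_ij lt_j => [|j IHj]; first by case: i.
  rewrite leq_eqVlt => /predU1P[-> //|le_ij] lt_j.
  exact: leq_trans (part_anti _ lt_j) (IHj le_ij (ltnW lt_j)).
exists [seq x <- s | 0 < x].
have hmu : is_intpart [seq x <- s | 0 < x].
  rewrite /is_intpart mem_filter andbT sorted_filter //.
    by move=> x y z /= le_xy le_zx; apply: leq_trans le_xy.
  apply/(sortedP 0) => i _; exact: s_anti.
split=> //; first by rewrite size_filter (leq_trans (count_size _ _)) ?size_mkseq.
move=> p; apply: eq_lt_nat => i; rewrite ltn_rim // nth_filter_pos //.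
case: (ltnP i N) => [lt_i|le_i] /=; last first.
  by have := rho_anti 0 p; lia.
rewrite nth_mkseq //; case: (ltnP (p + i) N) => [lt_N|le_N].
  by have := rho_lip 0 p; lia.
by have := partP i (p + i - N) lt_i; rewrite (_ : _ - N + N - i = p); lia.
Qed.

(** Lowering the path by one on []s, s + l]] changes only the steps [s] and [s + l]; the gap becomes
    a bead and the bead a gap, so it remains a lattice path. *)
Lemma rim_shift_exists (N l : nat) (la : seq nat) (s : nat) :
  is_intpart la -> ~~ bead N la s -> bead N la (s + l) ->
  exists mu, [/\ is_intpart mu, size mu <= N & rim_shift N l la mu s].
Proof.
move=> hla gs bs.
have l_gt0 : 0 < l by case: l bs gs => //; rewrite addn0 => ->.
have pos p : s < p <= s + l -> 0 < rim N la p.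
  by move=> hp; have := rim_antitone N hla (p := p) (q := s + l); rewrite /bead in bs; lia.
pose rho p := rim N la p - (s < p <= s + l).
have [||| mu [hmu hM eq_rho]] := @rim_realize N (nth 0 la 0 + N + s + l).+1 rho.
- by rewrite /rho rim0 // subn0.
- move=> p; rewrite /rho; have := rimS N p hla.
  have := pos p; have := pos p.+1.
  by have [-> |] := eqVneq p s; [|have [-> |] := eqVneq p (s + l)]; lia.
- by rewrite /rho; have := ltn_rim N (nth 0 la 0 + N + s + l).+1 0 hla; lia.
exists mu; split=> // p; rewrite eq_rho /rho subnK //.
by have := pos p; lia.
Qed.

(** * Shape of the hook removed by a border shift *)

Section Shift.

Variables (N l : nat) (la mu : seq nat) (s : nat).
Hypotheses (hla : is_intpart la) (hmu : is_intpart mu).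
Hypotheses (hN : size la <= N) (hM : size mu <= N).
Hypothesis sh : rim_shift N l la mu s.

Let R := (diagram la `\` diagram mu)%fset.
Let boxP b := rim_shift_boxP b hla hmu hN hM sh.

Lemma rim_shift_sub : (diagram mu `<=` diagram la)%fset.
Proof.
apply/fsubsetP => -[i j].
by rewrite (in_diagram_rim i j hla hN) (in_diagram_rim i j hmu hM) sh; lia.
Qed.

Lemma share_edge_rim_box (p : nat) : s < p -> p < s + l ->
  share_edge (rim_box N la p) (rim_box N la p.+1).
Proof.
move=> lt_sp lt_p; rewrite /share_edge /rim_box /=.
have := rim_geq N p hmu; have := rim_geq N p.+1 hmu.
by have := sh p; have := sh p.+1; have := rimS N p hla; case: (bead N la p); lia.
Qed.

Lemma share_edgeC (b c : box) : share_edge b c = share_edge c b.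
Proof. by case: b c => [? ?] [? ?]; rewrite /share_edge /=; lia. Qed.

Lemma rim_shift_connected : connected_boxes R.
Proof.
have fwd d p : s < p -> p + d <= s + l ->
    exists q, [/\ path share_edge (rim_box N la p) q,
                  last (rim_box N la p) q = rim_box N la (p + d) &
                  {subset q <= R}].
  elim: d p => [|d IHd] p lt_sp le_p; first by exists [::]; rewrite addn0.
  have [||q [pq lq sq]] := IHd p.+1; [lia | lia |].
  exists (rim_box N la p.+1 :: q); split=> /=.
  - by rewrite share_edge_rim_box //; lia.
  - by rewrite lq addSnnS.
  - move=> b; rewrite inE => /predU1P[->|/sq //].
    by apply/boxP; exists p.+1 => //; lia.
have bwd d p : s < p -> p + d <= s + l ->
    exists q, [/\ path share_edge (rim_box N la (p + d)) q,
                  last (rim_box N la (p + d)) q = rim_box N la p &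
                  {subset q <= R}].
  elim: d => [|d IHd] lt_sp le_p; first by exists [::]; rewrite addn0.
  have [||q [pq lq sq]] := IHd; [lia | lia |].
  exists (rim_box N la (p + d) :: q); split=> //=.
  - by rewrite addnS share_edgeC share_edge_rim_box //; lia.
  - move=> b; rewrite inE => /predU1P[->|/sq //].
    by apply/boxP; exists (p + d) => //; lia.
move=> b c /boxP[p hp ->] /boxP[q hq ->].
have [le_pq|lt_qp] := leqP p q.
  by have := fwd (q - p) p; rewrite subnKC //; apply; lia.
by have := bwd (p - q) q; rewrite subnKC ?(ltnW lt_qp) //; apply; lia.
Qed.

Lemma rim_shift_removal : rim_hook_removal l la R mu.
Proof.
split; last by split=> //; rewrite fsetDK // rim_shift_sub.
split; [exact: fsubsetDl | exact: card_rim_shift hN hM sh | exact: rim_shift_connected |].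
(* Opposite corners [(i, j)] and [(i + 1, j + 1)] lie on one diagonal, which holds a single removed
   box. *)
case=> i [j [/boxP[p hp [ei ej]] _ _ /boxP[q hq [ei' ej']]]].
have := rim_geq N p hmu; have := rim_geq N q hmu; have := sh p; have := sh q.
have [epq|] := eqVneq p q; last by lia.
by move: ei'; rewrite -epq; lia.
Qed.

(** From the box on diagonal [p] to the one on [p + 1] the border makes step [p], which keeps the
    row exactly when it is a gap. *)
Lemma rim_shift_horizontal :
  horizontal R <-> (forall p, s < p < s + l -> ~~ bead N la p).
Proof.
split=> [[i hi] p hp|gaps].
  have /hi/= : rim_box N la p \in R by apply/boxP; exists p => //; lia.
  have /hi/= : rim_box N la p.+1 \in R by apply/boxP; exists p.+1 => //; lia.
  by have := sh p; have := sh p.+1; have := rimS N p hla; lia.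
exists (rim N la s.+1).-1 => _ /boxP[p hp ->] /=; congr _.-1.
elim: p hp => // p IHp hp; have [-> //|ne_s] := eqVneq p s.
rewrite -IHp; last by lia.
by have := rimS N p hla; rewrite (negPf (gaps p _)); lia.
Qed.

Lemma rim_shift_vertical :
  vertical R <-> (forall p, s < p < s + l -> bead N la p).
Proof.
split=> [[i hi] p hp|beads].
  have /hi/= : rim_box N la p \in R by apply/boxP; exists p => //; lia.
  have /hi/= : rim_box N la p.+1 \in R by apply/boxP; exists p.+1 => //; lia.
  have := sh p; have := sh p.+1; have := rimS N p hla.
  by have := rim_geq N p hmu; have := rim_geq N p.+1 hmu; lia.
exists ((s.+1 + rim N la s.+1).-1 - N) => _ /boxP[p hp ->] /=.
suff : p + rim N la p = s.+1 + rim N la s.+1 by have := sh p; lia.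
elim: p hp => // p IHp hp; have [-> //|ne_s] := eqVneq p s.
by have := rimS N p hla; rewrite (beads p _); lia.
Qed.

End Shift.

(** * Adjacency of successive hooks *)

Section Adjacent.

Variables (N l : nat) (la mu nu : seq nat) (s t : nat).
Hypotheses (hla : is_intpart la) (hmu : is_intpart mu) (hnu : is_intpart nu).
Hypotheses (hN : size la <= N) (hM : size mu <= N) (hK : size nu <= N).
Hypotheses (l_gt0 : 0 < l).
Hypotheses (sh1 : rim_shift N l la mu s) (sh2 : rim_shift N l mu nu t).

(** The hooks then occupy consecutive intervals of diagonals, and the boxes at the common end share
    an edge. *)
Lemma adjacent_shift : t = s + l \/ s = t + l ->
  adjacent (diagram la `\` diagram mu)%fset (diagram mu `\` diagram nu)%fset.
Proof.
have [gs bs _] := rim_shift_bead hla hmu l_gt0 sh1.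
have [gt bt _] := rim_shift_bead hmu hnu l_gt0 sh2.
have rs p := rimS N p hla; have rt p := rimS N p hmu.
case=> [et|es].
  exists (rim_box N la t), (rim_box N mu t.+1); split.
  - by apply/(rim_shift_boxP _ hla hmu hN hM sh1); exists t => //; lia.
  - by apply/(rim_shift_boxP _ hmu hnu hM hK sh2); exists t.+1 => //; lia.
  rewrite /share_edge /rim_box /=; rewrite -et in bs.
  have := rs t; have := rt t; rewrite (negPf gt) bs.
  have := sh1 t; have := sh1 t.+1; have := sh2 t.+1.
  by have := rim_geq N t hmu; have := rim_geq N t.+1 hnu; lia.
exists (rim_box N la s.+1), (rim_box N mu s); split.
- by apply/(rim_shift_boxP _ hla hmu hN hM sh1); exists s.+1 => //; lia.
- by apply/(rim_shift_boxP _ hmu hnu hM hK sh2); exists s => //; lia.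
rewrite /share_edge /rim_box /=; rewrite -es in bt.
have := rs s; have := rt s; rewrite (negPf gs) bt.
have := sh1 s; have := sh1 s.+1; have := sh2 s.
by have := rim_geq N s.+1 hmu; have := rim_geq N s hnu; lia.
Qed.

Lemma adjacent_shift_near :
  adjacent (diagram la `\` diagram mu)%fset (diagram mu `\` diagram nu)%fset ->
  exists p q, [/\ s < p <= s + l, t < q <= t + l & p = q.+1 \/ q = p.+1].
Proof.
case=> b [c [/(rim_shift_boxP _ hla hmu hN hM sh1)[p hp ->]]].
case/(rim_shift_boxP _ hmu hnu hM hK sh2) => q hq -> e.
exists p, q; split=> //; move: e; rewrite /share_edge /rim_box /=.
by have := rim_geq N p hmu; have := rim_geq N q hnu; have := sh1 p; have := sh2 q; lia.
Qed.

End Adjacent.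

(** * Violations *)

(* Unlike a bare modn, this is opaque to lia. *)
Definition residue (l p : nat) : nat := p %% l.

Lemma residueD (l p : nat) : residue l (p + l) = residue l p.
Proof. exact: modnDr. Qed.

Lemma residue_between (l s p : nat) : s < p < s + l -> residue l p <> residue l s.
Proof.
move=> hp /eqP; rewrite eqn_mod_dvd; last by lia.
by move/dvdn_leq; lia.
Qed.

Lemma violationP (l : nat) (X : pred nat) :
  violation l X <->
  exists b g g' b' : nat,
    [/\ X b, ~~ X g, ~~ X g' & X b'] /\
    [/\ g < b, g' < b & g < b'] /\
    [/\ residue l b = residue l g, residue l g' <> residue l g &
        residue l b' <> residue l g].
Proof.
rewrite /residue; split=> -[b [g [g' [b' [hX [[lt_gb lt_g'b lt_gb'] [e1 e2 e3]]]]]]];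
  exists b, g, g', b'; do 2!split=> //.
  move: e1 e2 e3; rewrite -!eqn_mod_dvd ?(ltnW lt_gb) ?(ltnW lt_g'b) ?(ltnW lt_gb') //.
  by move=> /eqP e1 /eqP e2 /eqP e3; split=> // e; apply: e2; rewrite e1 e.
rewrite -!eqn_mod_dvd ?(ltnW lt_gb) ?(ltnW lt_g'b) ?(ltnW lt_gb') //.
split; [exact/eqP | | exact/eqP].
by apply/eqP => e; apply: e2; rewrite -e1.
Qed.

(** Undoing the move raises beads and lowers gaps along their runners, so residues and all
    inequalities between a gap and a bead survive. *)
Lemma violation_moved (l : nat) (X Y : pred nat) (s : nat) : 0 < l ->
  Y =1 moved l X s -> ~~ X s -> X (s + l) -> violation l Y -> violation l X.
Proof.
move=> l_gt0 eqY gs bs /violationP[b [g [g' [b' [[Yb Yg Yg' Yb'] [lts rs]]]]]].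
pose up p := if p == s then s + l else p.
pose dn p := if p == s + l then s else p.
have beadY p : Y p -> [/\ X (up p), p <= up p & residue l (up p) = residue l p].
  by rewrite eqY /moved /up; case: eqVneq => [->|] /=; rewrite ?residueD ?leq_addr // => _ /andP[].
have gapY p : ~~ Y p -> [/\ ~~ X (dn p), dn p <= p & residue l (dn p) = residue l p].
  rewrite eqY /moved /dn; case: (eqVneq p (s + l)) => [->|] /=; rewrite ?residueD ?leq_addr //.
  by case: (p == s); case: (X p).
apply/violationP; exists (up b), (dn g), (dn g'), (up b').
have [] := beadY _ Yb; have [] := beadY _ Yb'; have [] := gapY _ Yg; have [] := gapY _ Yg'.
move=> ? ? -> ? ? -> ? ? -> ? ? ->; split=> //; split=> //.
by case: lts; split; lia.
Qed.

Definition all_beads (l : nat) (X : pred nat) (s : nat) : Prop :=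
  forall p, s < p < s + l -> X p.

Definition all_gaps (l : nat) (X : pred nat) (s : nat) : Prop :=
  forall p, s < p < s + l -> ~~ X p.

(** A gap and a bead strictly between [s] and [s + l] form a violation together with these two
    ends. *)
Lemma violation_free_straight (l : nat) (X : pred nat) (s : nat) :
  ~ violation l X -> ~~ X s -> X (s + l) -> all_gaps l X s \/ all_beads l X s.
Proof.
move=> nv gs bs; have [/allP allX|/allPn[q]] := boolP (all X (iota s.+1 l.-1)).
  by right=> p hp; apply: allX; rewrite mem_iota; lia.
rewrite mem_iota => hq gq; left=> p hp; apply/negP => bp; apply: nv; apply/violationP.
exists (s + l), s, q, p; split=> //; split; first by split; lia.
by split; [rewrite residueD | apply: residue_between; lia | apply: residue_between].
Qed.

Definition turn (l : nat) (X Y : pred nat) (s t : nat) : Prop :=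
  (all_beads l X s /\ all_gaps l Y t) \/ (all_gaps l X s /\ all_beads l Y t).

(** Base points at distance at most [l] are forced to distance exactly [l], and then an explicit
    violation appears in each of the four cases. *)
Lemma violation_free_turn (l : nat) (X Y : pred nat) (s t : nat) : 1 < l ->
  Y =1 moved l X s -> ~ violation l X ->
  ~~ X s -> X (s + l) -> ~~ Y t -> Y (t + l) -> turn l X Y s t ->
  t + l < s \/ s + l < t.
Proof.
move=> l_gt1 eqY nv gs bs gt bt tn.
have viol b g g' b' : X b -> ~~ X g -> ~~ X g' -> X b' ->
    g < b -> g' < b -> g < b' ->
    residue l b = residue l g -> residue l g' <> residue l g ->
    residue l b' <> residue l g -> False.
  by move=> *; apply: nv; apply/violationP; exists b, g, g', b'.
have [|] := ltnP (t + l) s; first by left.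
have [|] := ltnP (s + l) t; first by right.
move=> le_t le_s; exfalso.
have Yp p : p != s -> p != s + l -> Y p = X p by rewrite eqY /moved => /negPf-> ->.
have Ys : Y s by rewrite eqY /moved eqxx.
have Ysl : ~~ Y (s + l) by rewrite eqY /moved eqxx orbF; lia.
case: tn => -[hX hY].
  have Ygap p : t <= p < t + l -> ~~ Y p.
    by rewrite leq_eqVlt; case: (eqVneq t p) => [<- //|_] /= hp; apply: hY.
  have Ybead p : s <= p < s + l -> Y p.
    rewrite leq_eqVlt; case: (eqVneq s p) => [<- //|_] /= hp.
    by rewrite Yp ?hX //; lia.
  (* [Y] has beads on [[s, s + l[] and gaps on [[t, t + l[]; [maxn s t] would lie in both if
     [|s - t| < l]. *)
  have [es|et] : s = t + l \/ t = s + l.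
    have := Ygap (maxn s t); have := Ybead (maxn s t).
    by case: (Y _); lia.
    subst s; apply: (viol (t + l + l) (t + l) (t + l).-1 (t + l).+1) => //; try lia.
    + by rewrite -Yp ?Ygap; lia.
    + by apply: hX; lia.
    + by rewrite residueD.
    + by move/esym; apply: residue_between; lia.
    + by apply: residue_between; lia.
  subst t; apply: (viol (s + l + l) s (s + l).+1 s.+1) => //; try lia.
  + by rewrite -Yp //; lia.
  + by rewrite -Yp ?Ygap; lia.
  + by apply: hX; lia.
  + by rewrite !residueD.
  + by rewrite -(residueD l s); apply: residue_between; lia.
  + by apply: residue_between; lia.
have Ybead p : t < p <= t + l -> Y p.
  by case: (eqVneq p (t + l)) => [-> //|ne] /= hp; apply: hY; lia.
have Ygap p : s < p <= s + l -> ~~ Y p.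
  case: (eqVneq p (s + l)) => [-> //|ne] /= hp.
  by rewrite Yp ?hX //; lia.
(* Here [Y] has gaps on []s, s + l]] and beads on []t, t + l]], hence the successor of
   [maxn s t]. *)
have [es|et] : s = t + l \/ t = s + l.
  have := Ygap (maxn s t).+1; have := Ybead (maxn s t).+1.
  by case: (Y _); lia.
  subst s; apply: (viol (t + l + l) t (t + l).+1 t.+1) => //; try lia.
  + by rewrite -Yp //; lia.
  + by apply: hX; lia.
  + by rewrite -Yp ?Ybead; lia.
  + by rewrite !residueD.
  + by rewrite -(residueD l t); apply: residue_between; lia.
  + by apply: residue_between; lia.
subst t; apply: (viol (s + l) s s.+1 (s + l).+1) => //; try lia.
+ by apply: hX; lia.
+ by rewrite -Yp ?Ybead; lia.
+ by rewrite residueD.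
+ by apply: residue_between; lia.
+ by rewrite -(residueD l s); apply: residue_between; lia.
Qed.

(** Descending from [y] in steps of [l], the first gap met lies directly below a bead. *)
Lemma runner_descent (l : nat) (X : pred nat) (x y : nat) : 0 < l ->
  ~~ X x -> X y -> x < y -> residue l y = residue l x ->
  exists s, [/\ ~~ X s, X (s + l), x <= s, s + l <= y & residue l s = residue l x].
Proof.
move=> l_gt0; elim/ltn_ind: y => y IHy gx by_ lt_xy e.
have le_y : x + l <= y.
  by rewrite leqNgt; apply/negP => lt_y; apply: (@residue_between l x y) e; rewrite lt_xy.
have [z ey] : exists z, y = z + l by exists (y - l); lia.
have ez : residue l z = residue l x by rewrite -e ey residueD.
have [bz|gz] := boolP (X z); last by exists z; rewrite -ey; split=> //; lia.
have ne_xz : x <> z by move=> exz; rewrite exz bz in gx.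
have [||s [? ? ? ? ?]] := IHy z _ gx bz _ ez; [lia | lia |].
by exists s; split=> //; lia.
Qed.

(** * A minimal configuration with a violation *)

Section MinimalViolation.

Variables (l : nat) (X : pred nat).
Hypothesis l_gt2 : 2 < l.
(** All that is kept of a smallest counterexample: its moves are straight and destroy every
    violation, and the next moves are straight and make no adjacent turn. *)
Hypothesis moveX : forall s, ~~ X s -> X (s + l) -> exists Y : pred nat,
  [/\ Y =1 moved l X s,
      ~ violation l Y,
      all_gaps l X s \/ all_beads l X s &
      forall t, ~~ Y t -> Y (t + l) ->
        (all_gaps l Y t \/ all_beads l Y t) /\
        (t = s + l \/ s = t + l -> ~ turn l X Y s t)].

(* The quadruple may use the bead that the move creates at s and the gap that it
   leaves at s + l; by moveX it is not a violation after the move. *)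
Let move_kills s b g g' b' : ~~ X s -> X (s + l) ->
  X b || (b == s) -> ~~ X g || (g == s + l) ->
  ~~ X g' || (g' == s + l) -> X b' || (b' == s) ->
  g < b -> g' < b -> g < b' ->
  residue l b = residue l g -> residue l g' <> residue l g -> residue l b' <> residue l g ->
  [\/ b = s + l, g = s, g' = s | b' = s + l].
Proof.
move=> gs bs Xb Xg Xg' Xb' lt1 lt2 lt3 r1 r2 r3.
have [Y [eqY nvY _ _]] := moveX gs bs.
have [->|nb] := eqVneq b (s + l); first by constructor 1.
have [->|ng] := eqVneq g s; first by constructor 2.
have [->|ng'] := eqVneq g' s; first by constructor 3.
have [->|nb'] := eqVneq b' (s + l); first by constructor 4.
case: nvY; apply/violationP; exists b, g, g', b'; rewrite !eqY /moved nb nb'.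
by rewrite (negPf ng) (negPf ng') /=; split=> //; split; lia.
Qed.

Section Violation.

Variables b g g' b' : nat.
Hypotheses (Xb : X b) (Xg : ~~ X g) (Xg' : ~~ X g') (Xb' : X b').
Hypotheses (lt_gb : g < b) (lt_g'b : g' < b) (lt_gb' : g < b').
Hypotheses (rb : residue l b = residue l g).
Hypotheses (rg' : residue l g' <> residue l g) (rb' : residue l b' <> residue l g).

(** With [c := b - l] above [g], off-runner positions are forced to be gaps high up or beads low
    down, which produces an adjacent turn at [g] or at [c]. *)
Let no_far : b <> g + l -> False.
Proof.
move=> ne_b; have le_b : g + l <= b.
  by rewrite leqNgt; apply/negP => lt_b; apply: (@residue_between l g b) rb; rewrite lt_gb.
have [c eqb] : exists c, b = c + l by exists (b - l); lia.
have rc : residue l c = residue l g by rewrite -rb eqb residueD.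
have le_c : g + l <= c.
  rewrite leqNgt; apply/negP => lt_c; apply: (@residue_between l g c) rc.
  by apply/andP; split; lia.
(* A move on this runner between [g] and [b] must destroy the violation, so it fills [g] or takes
   away [b]. *)
have ends s : ~~ X s -> X (s + l) -> g <= s -> s + l <= b -> residue l s = residue l g ->
    s = g \/ s = c.
  move=> gs bs le_gs le_s rs.
  have [] // := @move_kills s b g g' b' gs bs; rewrite ?Xb ?Xg ?Xg' ?Xb' //.
  - by lia.
  - by move=> ->; left.
  - by move=> e; case: rg'; rewrite e.
  - by move=> e; case: rb'; rewrite e residueD.
(* After the move into [g], the new gap [g + l] replaces [g] in the violation, so [p] cannot serve
   as [b']. *)
have high_gap p : X (g + l) -> g + l < p -> residue l p <> residue l g -> ~~ X p.
  move=> bgl lt_p rp; apply/negP => Xp.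
  have [] := @move_kills g b (g + l) g' p Xg bgl; rewrite ?Xb ?Xg' ?Xp ?eqxx ?orbT ?residueD //.
  - by lia.
  - by lia.
  - by move=> e; case: rg'; rewrite e.
  - by lia.
(* After the move of [b] into [c], the new bead [c] replaces [b], so [p] cannot serve as [g']. *)
have low_bead p : ~~ X c -> p < c -> residue l p <> residue l g -> X p.
  move=> gc lt_p rp; apply/negPn/negP => Xp.
  have Xcl : X (c + l) by rewrite -eqb.
  have [] := @move_kills c c g p b' gc Xcl; rewrite ?Xg ?Xp ?Xb' ?eqxx ?orbT //.
  - by lia.
  - by lia.
  - by lia.
  - by lia.
  - by move=> e; case: rb'; rewrite e -eqb.
have [bc|gc] := boolP (X c).
  have bgl : X (g + l).
    have [||s [gs bs le_gs le_s rs]] := @runner_descent l X g c _ Xg bc _ rc; [lia | lia |].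
    have le_sb : s + l <= b by lia.
    by have [es|es] := ends s gs bs le_gs le_sb rs; [rewrite -es | lia].
  have bg2l : X (g + l + l).
    apply/negPn/negP => g2l; have ne_c : c <> g + l.
      by move=> e; move: g2l; rewrite -e -eqb Xb.
    have ne_c2 : c <> g + l + l by move=> e; rewrite -e bc in g2l.
    have lt_c2 : g + l + l < c.
      rewrite ltnNge; apply/negP => le_c2; apply: (@residue_between l (g + l) c).
        by lia.
      by rewrite residueD.
    have [|||s [gs bs le_gs le_s rs]] := @runner_descent l X (g + l + l) c _ g2l bc.
    - by lia.
    - by [].
    - by rewrite !residueD.
    by have [|||es|es] := ends s gs bs; rewrite ?rs ?residueD //; lia.
  have lt_b' : b' < g + l.
    rewrite ltnNge; apply/negP => le_b'; have := @high_gap b' bgl _ rb'.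
    rewrite Xb' ltn_neqAle le_b' andbT => H; have := negP (H _); apply=> //.
    by apply/eqP => e; case: rb'; rewrite -e residueD.
  (* The hook at [g] contains the bead [b'], hence is vertical; the next one, at [g + l], is
     horizontal by [high_gap]. *)
  have [Y [eqY _ str tn]] := moveX Xg bgl.
  have Yp p : g + l < p -> Y p = X p.
    by move=> lt_p; rewrite eqY /moved; case: eqP => [|_]; [lia | case: eqP => //; lia].
  have [||_ []] := tn (g + l).
  - by rewrite eqY /moved eqxx orbF; lia.
  - by rewrite Yp //; lia.
  - by left.
  left; split.
    case: str => // gaps; have := gaps b'; rewrite Xb' lt_gb' lt_b' => /(_ isT) //.
  move=> p hp; rewrite Yp; last by lia.
  apply: high_gap => //; first by lia.
  by rewrite -(residueD l g); apply: residue_between; lia.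
have Xcl : X (c + l) by rewrite -eqb.
(* If [g + l] is a bead, [high_gap] and [low_bead] contradict each other at [g + l + 1]. *)
have [bgl|ggl] := boolP (X (g + l)).
  have ne_c : c <> g + l by move=> e; rewrite e bgl in gc.
  have lt_c2 : g + l + l <= c.
    rewrite leqNgt; apply/negP => lt_c2; apply: (@residue_between l (g + l) c).
      by lia.
    by rewrite residueD.
  have r1 : residue l (g + l).+1 <> residue l g.
    by rewrite -(residueD l g); apply: residue_between; lia.
  have := @high_gap (g + l).+1 bgl _ r1; rewrite low_bead //; last by lia.
  by move=> /(_ (ltnSn _)).
have [d eqc] : exists d, c = d + l by exists (c - l); lia.
have rd : residue l d = residue l g by rewrite -rc eqc residueD.
have gd : ~~ X d.
  apply/negP => bd; have ne_d : d <> g by move=> e; rewrite e (negPf Xg) in bd.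
  have [||s [gs bs le_gs le_s rs]] := @runner_descent l X g d _ Xg bd _ rd; [lia | lia |].
  have le_sb : s + l <= b by lia.
  have [es|es] := ends s gs bs le_gs le_sb rs; last by lia.
  by rewrite es (negPf ggl) in bs.
have lt_cg' : c < g'.
  rewrite ltnNge; apply/negP => le_g'; move: Xg'; rewrite low_bead //.
  by rewrite ltn_neqAle le_g' andbT; apply/eqP => e; case: rg'; rewrite e.
(* The hook at [c] contains the gap [g'], hence is horizontal; the next one, at [d = c - l], is
   vertical by [low_bead]. *)
have [Y [eqY _ str tn]] := moveX gc Xcl.
have Yp p : p < c -> Y p = X p.
  by move=> lt_p; rewrite eqY /moved; case: eqP => [|_]; [lia | case: eqP => //; lia].
have [||_ []] := tn d.
- by rewrite Yp //; lia.
- by rewrite -eqc eqY /moved eqxx.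
- by right.
right; split.
  by case: str => // beads; move: Xg'; rewrite beads //; lia.
move=> p hp; rewrite Yp; last by lia.
apply: low_bead => //; first by lia.
by rewrite -rd; apply: residue_between; lia.
Qed.

Let no_near_beads : b = g + l -> all_beads l X g -> False.
Proof.
move=> eqb beads; have bs : X (g + l) by rewrite -eqb.
have lt_g'g : g' < g.
  have [//|lt|eg] := ltngtP g' g; last by case: rg'; rewrite eg.
  by move: Xg'; rewrite beads //; lia.
(* Climb from [g'] in steps of [l]: were [h + l] a bead, moving it to [h] would leave a gap at
   [h + l] that serves as [g'], with [g + 1] as [b']. *)
have near n h : ~~ X h -> residue l h <> residue l g -> h < g -> g - h < n ->
    exists h, [/\ ~~ X h, h < g & g < h + l].
  elim: n h => // n IHn h Xh rh lt_hg le_n.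
  have [lt_g|le_g] := ltnP g (h + l); first by exists h.
  have rhl : residue l (h + l) <> residue l g by rewrite residueD.
  have ne_g : h + l <> g by move=> e; case: rhl; rewrite e.
  have Xhl : ~~ X (h + l).
    apply/negP => bhl.
    have Xg1 : X g.+1 by apply: beads; lia.
    have rg1 : residue l g.+1 <> residue l g by apply: residue_between; lia.
    have [] := @move_kills h b g (h + l) g.+1 Xh bhl; rewrite ?Xb ?Xg ?Xg1 ?eqxx ?orbT //; lia.
  by apply: (IHn (h + l)) => //; lia.
have [h [Xh lt_h lt_hg]] := near _ _ Xg' rg' lt_g'g (ltnSn _).
have bhl : X (h + l) by apply: beads; lia.
have [Y [eqY _ str tn]] := moveX Xh bhl.
(* The hook at [h] contains the gap [g], so it is horizontal and must stop before the bead
   [g + 2]. *)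
have eqh : h + l = g.+1.
  case: str => [gaps|/(_ g)]; last by rewrite (negPf Xg) lt_hg lt_h => /(_ isT).
  have [//|ne_h] := eqVneq (h + l) g.+1; have := gaps g.+1.
  by rewrite beads; lia.
have Yp p : p != h -> p != h + l -> Y p = X p.
  by rewrite eqY /moved => /negPf-> ->.
have [||[gaps|beadsY] _] := tn g.
- by rewrite Yp //; lia.
- by rewrite Yp //; lia.
(* [g + 2] lies below [g + l] because [l > 2], and is still a bead, whereas [g + 1] has become a
   gap. *)
- by have := gaps g.+2; rewrite Yp ?beads; lia.
- have := beadsY g.+1; rewrite -eqh eqY /moved eqxx orbF.
  by lia.
Qed.

(** The mirror image of [no_near_beads]: descend from [b'] to a bead just above [b]; moving it fills
    [b - 1] while [b - 2] stays a gap, which bends the hook at [g]. *)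
Let no_near_gaps : b = g + l -> all_gaps l X g -> False.
Proof.
move=> eqb gaps; have bs : X (g + l) by rewrite -eqb.
have lt_bb' : b < b'.
  have [lt|//|eb] := ltngtP b' b; last by case: rb'; rewrite eb.
  by have := gaps b'; rewrite Xb'; lia.
have near n p : X p -> residue l p <> residue l g -> b < p -> p - b < n ->
    exists h, [/\ X (h + l), h < b & b < h + l].
  elim: n p => // n IHn p Xp rp lt_p le_n.
  have [lt_b|le_b] := ltnP (p - l) b.
    by exists (p - l); rewrite subnK //; lia.
  have [h ep] : exists h, p = h + l by exists (p - l); lia.
  have rh : residue l h <> residue l g by rewrite -(residueD l h) -ep.
  have ne_h : h <> b by move=> e; case: rh; rewrite e.
  have Xh : X h.
    apply/negPn/negP => gh.
    have Xhl : X (h + l) by rewrite -ep.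
    have Xb1 : ~~ X b.-1 by apply: gaps; lia.
    have rb1 : residue l b.-1 <> residue l g by apply: residue_between; lia.
    have [] := @move_kills h b g b.-1 h gh Xhl; rewrite ?Xb ?Xg ?Xb1 ?eqxx ?orbT //; lia.
  by apply: (IHn h) => //; lia.
have [h [Xhl lt_hb lt_bh]] := near _ _ Xb' rb' lt_bb' (ltnSn _).
have gh : ~~ X h by apply: gaps; lia.
have [Y [eqY _ str tn]] := moveX gh Xhl.
have eqh : h.+1 = b.
  case: str => [/(_ b)|beads]; first by rewrite Xb lt_hb lt_bh => /(_ isT).
  have [//|ne_h] := eqVneq h.+1 b; have := gaps b.-1.
  by rewrite beads; lia.
have Yp p : p != h -> p != h + l -> Y p = X p.
  by rewrite eqY /moved => /negPf-> ->.
have [||[gapsY|beads] _] := tn g.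
- by rewrite Yp //; lia.
- by rewrite Yp //; lia.
- by have := gapsY h; rewrite eqY /moved eqxx; lia.
- by have := beads h.-1; have := gaps h.-1; rewrite Yp; lia.
Qed.

Lemma minimal_no_violation : False.
Proof.
have [eqb|/eqP/no_far //] := eqVneq b (g + l).
have bs : X (g + l) by rewrite -eqb.
have [_ [_ _ [gaps|beads] _]] := moveX Xg bs.
- exact: no_near_gaps.
- exact: no_near_beads.
Qed.

End Violation.
End MinimalViolation.

(** * Comparison *)

Lemma JM_rim_hooks_straight (l : nat) (la : seq nat) : 0 < l ->
  is_intpart la -> JM_partition l la -> rim_hooks_straight l la.
Proof.
move=> l_gt0 hla /(JM_violation l hla (leqnn _)) nv R [mu rem].
have hmu : is_intpart mu by case: rem => _ [].
have [hM eqR [s sh]] := rim_hook_shift hla (leqnn _) l_gt0 rem; subst R.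
have [gs bs _] := rim_shift_bead hla hmu l_gt0 sh.
rewrite (rim_shift_horizontal hla hmu (leqnn _) hM sh).
rewrite (rim_shift_vertical hla hmu (leqnn _) hM sh).
exact: violation_free_straight nv gs bs.
Qed.

Lemma JM_no_adjacent_turn (l : nat) (la : seq nat) : 1 < l ->
  is_intpart la -> JM_partition l la -> no_adjacent_turn l la.
Proof.
move=> l_gt1 hla /(JM_violation l hla (leqnn _)) nv R S mu rem1 [nu rem2] tn.
have l_gt0 := ltnW l_gt1.
have hmu : is_intpart mu by case: rem1 => _ [].
have hnu : is_intpart nu by case: rem2 => _ [].
have [hM eqR [s sh1]] := rim_hook_shift hla (leqnn _) l_gt0 rem1.
have [hK eqS [t sh2]] := rim_hook_shift hmu hM l_gt0 rem2; subst R S.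
have [gs bs eqY] := rim_shift_bead hla hmu l_gt0 sh1.
have [gt bt _] := rim_shift_bead hmu hnu l_gt0 sh2.
rewrite (rim_shift_horizontal hla hmu (leqnn _) hM sh1) in tn.
rewrite (rim_shift_vertical hla hmu (leqnn _) hM sh1) in tn.
rewrite (rim_shift_horizontal hmu hnu hM hK sh2) in tn.
rewrite (rim_shift_vertical hmu hnu hM hK sh2) in tn.
case/(adjacent_shift_near hla hmu hnu (leqnn _) hM hK l_gt0 sh1 sh2) => p [q [hp hq near]].
by case: (violation_free_turn l_gt1 eqY nv gs bs gt bt tn); lia.
Qed.

Lemma JM_removal (l : nat) (la mu : seq nat) (R : {fset box}) : 0 < l ->
  is_intpart la -> rim_hook_removal l la R mu ->
  JM_partition l la -> JM_partition l mu.
Proof.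
move=> l_gt0 hla rem /(JM_violation l hla (leqnn _)) nv.
have hmu : is_intpart mu by case: rem => _ [].
have [hM _ [s sh]] := rim_hook_shift hla (leqnn _) l_gt0 rem.
have [gs bs eqY] := rim_shift_bead hla hmu l_gt0 sh.
by apply/(JM_violation l hmu hM) => /(violation_moved l_gt0 eqY gs bs).
Qed.

Lemma straight_reachable_trans (l : nat) (la mu nu : seq nat) :
  straight_reachable l la mu -> straight_reachable l mu nu ->
  straight_reachable l la nu.
Proof.
move=> la_mu; elim=> // mu' nu' R _ la_mu' rem str.
exact: straight_reachable_step la_mu' rem str.
Qed.

(** Condition (1) makes [R] straight, so [mu] and all that is reachable from it are reachable from
    [la]. *)
Lemma generalized_partition_removal (l : nat) (la mu : seq nat) (R : {fset box}) :
  rim_hook_removal l la R mu -> generalized_partition l la ->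
  generalized_partition l mu.
Proof.
move=> rem [str _ reach].
have la_mu : straight_reachable l la mu.
  have strR : horizontal R \/ vertical R by apply: str; exists mu.
  exact: straight_reachable_step (straight_reachable_refl _ _) rem strR.
have [str_mu turn_mu] := reach mu la_mu.
by split=> // nu mu_nu; apply: reach; apply: straight_reachable_trans mu_nu.
Qed.

Lemma generalized_partition_JM (l : nat) (la : seq nat) : 2 < l ->
  is_intpart la -> generalized_partition l la -> JM_partition l la.
Proof.
move=> l_gt2; have l_gt0 : 0 < l by lia.
(* Induction on the number of boxes: after one removal the partition is smaller and still
   generalized, hence JM, which supplies the hypothesis on moves. *)
have [n le_n] := ubnP #|` diagram la|; elim: n la le_n => // n IHn la le_n hla gla.
have hN := leqnn (size la); set N := size la in hN.
apply/(JM_violation l hla hN) => /violationP[b [g [g' [b' [[Xb Xg Xg' Xb'] [[? ? ?] [? ? ?]]]]]]].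
apply: (@minimal_no_violation l (bead N la) l_gt2 _ b g g' b') => // s gs bs.
have [mu [hmu hM sh]] := rim_shift_exists hla gs bs.
have rem := rim_shift_removal hla hmu hN hM sh.
have [_ _ eqY] := rim_shift_bead hla hmu l_gt0 sh.
have gmu := generalized_partition_removal rem gla.
have [strla turnla _] := gla; have [strmu _ _] := gmu.
exists (bead N mu); split=> //.
- apply/(JM_violation l hmu hM)/IHn => //.
  have := cardfsDS (rim_shift_sub hla hmu hN hM sh).
  by rewrite (card_rim_shift hla hmu hN hM sh); lia.
- rewrite /all_gaps -(rim_shift_horizontal hla hmu hN hM sh).
  rewrite /all_beads -(rim_shift_vertical hla hmu hN hM sh).
  by apply: strla; exists mu.
move=> t gt bt; have [nu [hnu hK sh2]] := rim_shift_exists hmu gt bt.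
have rem2 := rim_shift_removal hmu hnu hM hK sh2.
rewrite /turn /all_gaps /all_beads.
rewrite -(rim_shift_horizontal hla hmu hN hM sh) -(rim_shift_vertical hla hmu hN hM sh).
rewrite -(rim_shift_horizontal hmu hnu hM hK sh2) -(rim_shift_vertical hmu hnu hM hK sh2).
split=> [|adj tn]; first by apply: strmu; exists nu.
apply: (turnla _ _ _ rem _ tn); first by exists nu.
exact: adjacent_shift hla hmu hnu hN hM hK l_gt0 sh sh2 adj.
Qed.

Theorem theorem2p6 (l : nat) (la : seq nat) (hl : 2 < l) (hla : is_intpart la) :
  JM_partition l la <-> generalized_partition l la.
Proof.
have l_gt0 : 0 < l by lia.
have l_gt1 : 1 < l by lia.
split=> [JMla|]; last exact: generalized_partition_JM.
(* Being JM is inherited along removals, so condition (3) reduces to (1) and (2) for JM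
   partitions. *)
have reach mu : straight_reachable l la mu -> is_intpart mu /\ JM_partition l mu.
  elim=> [//|mu' nu R _ [hmu' JMmu'] rem _].
  by split; [case: rem => _ [] | apply: JM_removal rem JMmu'].
split; [exact: JM_rim_hooks_straight | exact: JM_no_adjacent_turn |].
move=> mu /reach[hmu JMmu].
by split; [apply: JM_rim_hooks_straight | apply: JM_no_adjacent_turn].
Qed.
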